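(* Assume that the set $\mathcal{E}$ of positive detailed-balanced equilibria is nonempty. Let $\boldsymbol M^0\in\mathbb{R}_+^m$ be an initial mass vector and $\boldsymbol\zeta\in\mathbb{R}^{1\times m}$ be a row vector (with $\boldsymbol\zeta\mathbb{Q}=\boldsymbol M^\top$) such that $\boldsymbol\zeta\boldsymbol M^0=1$. Then there exists a unique positive detailed-balanced equilibrium $\boldsymbol x_\infty\in\mathcal{E}$ satisfying the conservation laws and the normalization condition $$\mathbb{Q}\boldsymbol c_\infty=\boldsymbol M^0,\qquad\sum_{i=1}^nx_{i\infty}=1,\qquad\text{where }c_{i\infty}=\frac{x_{i\infty}}{\sum_{j=1}^nM_jx_{j\infty}},\ i=1,\dots,n.$$
   Context: $\mathbb{R}_+=(0,\infty)$ and $\boldsymbol x^{\boldsymbol\alpha}=\prod_{i=1}^nx_i^{\alpha_i}$. Data: molar masses $M_i>0$ ($i=1,\dots,n$), $\boldsymbol M=(M_1,\dots,M_n)^\top$; vectors $\boldsymbol\alpha^a,\boldsymbol\beta^a$ with entries in $\{0\}\cup[1,\infty)$ and constants $k_f^a,k_b^a>0$ ($a=1,\dots,N$). $$\mathcal{E}=\{\boldsymbol x_\infty\in\mathbb{R}_+^n:\ k_f^a\boldsymbol x_\infty^{\boldsymbol\alpha^a}=k_b^a\boldsymbol x_\infty^{\boldsymbol\beta^a}\ \text{for all }a=1,\dots,N\}.$$ $\mathbb{W}=(\boldsymbol\beta^a-\boldsymbol\alpha^a)_{a=1,\dots,N}\in\mathbb{R}^{n\times N}$; conservation of total mass is assumed,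 so that $\boldsymbol M^\top\mathbb{W}=0$. $m=\dim\ker(\mathbb{W}^\top)\ge1$; $\mathbb{Q}\in\mathbb{R}^{m\times n}$ is a matrix whose rows form a basis of $\ker(\mathbb{W}^\top)$. The term initial mass vector refers to $\boldsymbol M^0=\mathbb{Q}\int_\Omega\boldsymbol c^0\,dz$, where $\Omega$ is a domain with $|\Omega|=1$ and $c_i^0=\rho_i^0/M_i$ are initial concentrations coming from integrable initial mass densities $\rho_i^0\ge0$ with $\sum_{i=1}^n\rho_i^0=1$ in $\Omega$ (the signs of the rows of $\mathbb{Q}$ are chosen such that $\boldsymbol M^0$ is positive).
   Formalization: Positivity of the entries of M⁰ alone does not guarantee a positive c with Qc = M⁰; the formal theorem also assumes that yM⁰ > 0 for every nonzero row vector y with yQ ≥ 0 entrywise, which is necessary for the conclusion. *)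

(* Defs.v *)
From HB Require Import structures.
From mathcomp Require Import all_boot all_order all_algebra.
From mathcomp Require Import all_classical all_reals all_analysis.

Set Implicit Arguments.
Unset Strict Implicit.
Unset Printing Implicit Defensive.

Import Order.TTheory GRing.Theory Num.Theory.
Import numFieldNormedType.Exports.

Local Open Scope classical_set_scope.
Local Open Scope ring_scope.

Definition positive_vector (R : realType) (n : nat) (x : 'cV[R]_n) : Prop :=
  forall i, 0 < x i 0.

Definition stoichiometric_exponents (R : realType) (n N : nat)
    (alpha : 'I_N -> 'cV[R]_n) : Prop :=
  forall a i, alpha a i 0 = 0 \/ 1 <= alpha a i 0.

Definition vpow (R : realType) (n : nat) (x e : 'cV[R]_n) : R :=
  \prod_(i < n) (x i 0 `^ e i 0).

Definition detailed_balanced (R : realType) (n N : nat)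
    (alpha beta : 'I_N -> 'cV[R]_n) (kf kb : 'I_N -> R) : set 'cV[R]_n :=
  [set x | positive_vector x /\
     forall a, kf a * vpow x (alpha a) = kb a * vpow x (beta a)].

Definition wegscheider (R : realType) (n N : nat)
    (alpha beta : 'I_N -> 'cV[R]_n) : 'M[R]_(n, N) :=
  \matrix_(i < n, a < N) (beta a i 0 - alpha a i 0).

(* The row space of [kermx W] is {q | q *m W = 0}, that is, the transposes of
   the vectors of ker(W^T); hence [\rank (kermx W)] is dim ker(W^T). *)
Definition kernel_basis (R : realType) (m n N : nat)
    (Q : 'M[R]_(m, n)) (W : 'M[R]_(n, N)) : Prop :=
  row_free Q /\ (Q :=: kermx W)%MS.

Definition concentration (R : realType) (n : nat) (M x : 'cV[R]_n) : 'cV[R]_n :=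
  \col_(i < n) (x i 0 / \sum_(j < n) M j 0 * x j 0).

(* R^d with its Borel sigma-algebra. *)
Definition borel_rV (R : realType) (d : nat) :=
  g_sigma_algebraType (@open 'rV[R]_d).

(* The library has Lebesgue measure only on R; on R^d it is the unique Borel
   measure giving every box the product of its side lengths. *)
Definition is_lebesgue_measure (R : realType) (d : nat)
    (mu : {measure set (borel_rV R d) -> \bar R}) : Prop :=
  forall a b : 'rV[R]_d, (forall k, a 0 k <= b 0 k) ->
    mu [set z : 'rV[R]_d | forall k, a 0 k <= z 0 k <= b 0 k] =
      (\prod_(k < d) (b 0 k - a 0 k))%:E.

Definition is_domain (R : realType) (d : nat) (Omega : set 'rV[R]_d) : Prop :=
  Omega !=set0 /\ open Omega /\ connected Omega.

Definition initial_densities (R : realType) (d n : nat)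
    (mu : {measure set (borel_rV R d) -> \bar R}) (Omega : set (borel_rV R d))
    (rho0 : 'I_n -> borel_rV R d -> R) : Prop :=
  (forall i, mu.-integrable Omega (EFin \o rho0 i)) /\
  (forall i z, Omega z -> 0 <= rho0 i z) /\
  (forall z, Omega z -> \sum_(i < n) rho0 i z = 1).

Definition initial_mass_vector (R : realType) (d m n : nat)
    (mu : {measure set (borel_rV R d) -> \bar R}) (Omega : set (borel_rV R d))
    (M : 'cV[R]_n) (Q : 'M[R]_(m, n)) (rho0 : 'I_n -> borel_rV R d -> R) :
    'cV[R]_m :=
  Q *m \col_(i < n) Rintegral mu Omega (fun z => rho0 i z / M i 0).

(* Every nontrivial nonnegative conserved quantity has positive initial value.
   Positivity of the entries of M0 depends on the choice of the basis Q and
   does not imply this: for A1 + A2 <-> 2 A3 with unit molar masses, take the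
   rows (1, 0, 1/2) and (1, 1, 1) for Q and only A1 present initially; then
   M0 = (1, 1), but Q c = M0 forces c2 + c3 / 2 = 0, so no positive c exists.
   The condition is necessary for Q c = M0 to have a positive solution c, as
   y^T M0 = (y^T Q) c, and it holds as soon as every species is present
   initially. *)
Definition conserved_quantities_positive (R : realType) (m n : nat)
    (Q : 'M[R]_(m, n)) (M0 : 'cV[R]_m) : Prop :=
  forall y : 'rV[R]_m, y != 0 ->
    (forall i, 0 <= (y *m Q) 0 i) -> 0 < (y *m M0) 0 0.

(* Main.v *)
(* Fix an equilibrium w. The positive equilibria are the points
   x i = w i * exp ((l Q) i) with l a row vector, since log (x / w) ranges over
   ker W^T, the row space of Q. Maximize the linear form l M0 over the convex set
   of l with sum_i x i <= 1. The row zeta and the positivity of the nonnegative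
   conserved quantities make this set nonempty and its superlevel sets bounded, so
   a maximizer exists; the constraint is active there, and the multiplier rule
   reads Q x = T M0, with T = M . x because zeta Q = M^T and zeta M0 = 1. This is
   the conservation law for the concentrations x / T. Uniqueness follows from
   the strict convexity of exp. *)
Require Import Defs.
From mathcomp Require Import all_boot all_order all_algebra.
From mathcomp Require Import all_classical all_reals all_analysis.
From mathcomp Require Import ring lra.
Import Order.TTheory GRing.Theory Num.Theory.
Import numFieldNormedType.Exports.
Local Open Scope classical_set_scope.
Local Open Scope ring_scope.
Set Implicit Arguments.
Unset Strict Implicit.
Unset Printing Implicit Defensive.

(** * Linear forms and bounded polyhedra *)

Lemma continuous_mulmx_coord (R : realType) (m k : nat) (A : 'M[R]_(m, k))
    (j : 'I_k) : continuous (fun y : 'rV[R]_m => (y *m A) 0 j).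
Proof.
have -> : (fun y : 'rV[R]_m => (y *m A) 0 j) =
    (fun y => \sum_l y 0 l * A l j) by apply/funext => y; rewrite mxE.
apply: continuous_big => [|l _ y].
  by move=> x; exact: add_continuous.
apply: cvgMr_tmp; first exact: nbhs_filter.
exact: (@coord_continuous R 1 m 0 l y).
Qed.

(** The sum [f] of the positive parts is continuous and positively homogeneous, and without
    recession directions it has a positive minimum on the unit sphere. Dividing by this minimum
    bounds the norm by a multiple of [f], which is at most [k * max 0 C] on the polyhedron. *)
Lemma polyhedron_bounded (R : realType) (m k : nat) (A : 'M[R]_(m, k)) (C : R) :
  (forall y : 'rV[R]_m, (forall j, (y *m A) 0 j <= 0) -> y = 0) ->
  bounded_set [set y : 'rV[R]_m | forall j, (y *m A) 0 j <= C].
Proof.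
move=> recA; pose f (y : 'rV[R]_m) := \sum_j Num.max 0 ((y *m A) 0 j).
have fge0 (y : 'rV[R]_m) j : 0 <= Num.max 0 ((y *m A) 0 j) by rewrite le_max lexx.
pose S := [set y : 'rV[R]_m | `|y| = 1].
have cf : continuous f.
  apply: continuous_big => [|j _ y]; first by move=> x; exact: add_continuous.
  apply: (@continuous_max _ _ (cst 0) (fun y : 'rV[R]_m => (y *m A) 0 j)).
    exact: cst_continuous.
  exact: continuous_mulmx_coord.
have cS : compact S.
  apply: bounded_closed_compact; last first.
    by apply: (preimage_closed _ (@closed_eq _ 1)) => y _; exact: norm_continuous.
  by exists 1; split=> // B /ltW B1 y /= ->.
(* If the unit sphere is empty, the space is zero. *)
have [S0|S0] := pselect (S !=set0); last first.
  exists 0; split=> // B B0 y /= _; suff -> : y = 0 by rewrite normr0 ltW.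
  have [//|y0] := eqVneq y 0; exfalso; apply: S0; exists (`|y|^-1 *: y).
  by rewrite /S /= normrZ normfV normr_id mulVf// normr_eq0.
have [c + cmin] := compact_EVT_min S0 cS (continuous_subspaceT cf).
rewrite inE /S /= => c1.
have fc : 0 < f c.
  rewrite lt_neqAle sumr_ge0 // andbT eq_sym.
  apply/negP => /eqP fc0; have c0 : c = 0.
    apply: recA => j; have /psumr_eq0P := fc0.
    by move=> /(_ (fun i _ => fge0 c i) j isT)/max_idPl.
  by move: c1; rewrite c0 normr0 => /esym/eqP; rewrite oner_eq0.
exists (k%:R * Num.max 0 C / f c); split=> [|B /ltW CB y /= yC]; first exact: num_real.
apply: le_trans CB.
have [->|y0] := eqVneq y 0.
  by rewrite normr0 divr_ge0 ?mulr_ge0 ?le_max ?lexx// ltW.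
have ny : 0 < `|y| by rewrite normr_gt0.
rewrite ler_pdivlMr //.
have fy : f y = `|y| * f (`|y|^-1 *: y).
  rewrite /f mulr_sumr; apply: eq_bigr => j _.
  have -> : ((`|y|^-1 *: y) *m A) 0 j = `|y|^-1 * (y *m A) 0 j.
    by rewrite -scalemxAl mxE.
  rewrite maxr_pMr// mulr0 mulrA mulfV ?mul1r//.
  by rewrite gt_eqF.
apply: (@le_trans _ _ (f y)).
  rewrite fy ler_pM2l// cmin// inE /S /= normrZ normfV normr_id mulVf//.
  by rewrite gt_eqF.
rewrite /f; apply: (@le_trans _ _ (\sum_(j < k) Num.max 0 C)).
  by apply: ler_sum => j _; rewrite ge_max !le_max lexx yC orbT.
by rewrite sumr_const card_ord mulr_natl.
Qed.

(** * Descent for sums of exponentials *)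

(** The bound [expR (- u) >= 1 - u] gives [expR u * (1 - u) <= 1], while [(1 + u + 2 * u ^+ 2) * (1
    - u) = 1 + u ^+ 2 * (1 - 2 * u)] is at least 1. *)
Lemma expR_le_quadratic (R : realType) (u : R) :
  u <= 2^-1 -> expR u <= 1 + u + 2 * u ^+ 2.
Proof.
move=> u2; have h := expR_ge1Dx (- u).
have : expR u * expR (- u) = 1 by rewrite expRN mulfV// expR_eq0.
have := expR_gt0 u; move: h; move: (expR u) (expR (- u)) => p q h p0 pq.
have : p * (1 - u) <= 1 by rewrite -[leRHS]pq ler_pM2l.
nra.
Qed.

Lemma exp_sum_descent (R : realType) (n : nat) (x s : 'I_n -> R) :
  (forall i, 0 < x i) -> \sum_i x i * s i < 0 ->
  exists2 e, 0 < e & \sum_i x i * expR (e * s i) < \sum_i x i.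
Proof.
move=> x0; set D := \sum_i _ => D0.
pose B := 1 + \sum_i `|s i|; pose V := \sum_i x i * s i ^+ 2.
have B0 : 0 < B by rewrite ltr_pwDl// sumr_ge0.
have V0 : 0 <= V by apply: sumr_ge0 => i _; rewrite mulr_ge0 ?sqr_ge0 ?ltW.
have sB i : s i <= B.
  apply: le_trans (ler_norm _) _; rewrite /B (bigD1 i)//=.
  have : 0 <= \sum_(j < n | j != i) `|s j| by apply: sumr_ge0.
  by lra.
(* The two terms of [K] ensure [e * B <= 1/2], so that the quadratic bound applies, and
   [2 * e * V < - D], so that the derivative [D] at 0 outweighs the error. *)
pose K := 2 * B * - D + 2 * V.
have K0 : 0 < K by rewrite /K; nra.
pose e := - D / K; have e0 : 0 < e by rewrite divr_gt0// oppr_gt0.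
have eK : e * K = - D by rewrite /e mulfVK// gt_eqF.
exists e => //.
have eB : e * B <= 2^-1.
  rewrite /e mulrAC ler_pdivrMr// /K; nra.
have : \sum_i x i * expR (e * s i) <=
    \sum_i (x i + (e * (x i * s i) + 2 * e ^+ 2 * (x i * s i ^+ 2))).
  apply: ler_sum => i _.
  have es : e * s i <= 2^-1 by apply: le_trans eB; rewrite ler_pM2l.
  apply: (@le_trans _ _ (x i * (1 + e * s i + 2 * (e * s i) ^+ 2))).
    by rewrite ler_pM2l// expR_le_quadratic.
  by rewrite le_eqVlt; apply/predU1P; left; ring.
move=> /le_lt_trans; apply.
rewrite !big_split /= -!mulr_sumr -/D -/V.
have : 2 * e * V < - D.
  have : 0 < e * (B * - D) by rewrite mulr_gt0// mulr_gt0// oppr_gt0.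
  by move=> ?; rewrite -eK /K; lra.
by nra.
Qed.

(** * The exponential family and its constrained maximizer *)

Lemma mulmx_combination_coord (R : realType) (m k : nat) (A : 'M[R]_(m, k))
    (u v : 'rV[R]_m) (c : R) j :
  ((u + c *: v) *m A) 0 j = (u *m A) 0 j + c * (v *m A) 0 j.
Proof. by rewrite mulmxDl -scalemxAl mxE [X in _ + X]mxE. Qed.

Definition exp_family (R : realType) (m n : nat) (w : 'cV[R]_n)
    (Q : 'M[R]_(m, n)) (l : 'rV[R]_m) : 'cV[R]_n :=
  \col_i (w i 0 * expR ((l *m Q) 0 i)).

Lemma continuous_exp_family_sum (R : realType) (m n : nat) (w : 'cV[R]_n)
    (Q : 'M[R]_(m, n)) : continuous (fun l => \sum_i exp_family w Q l i 0).
Proof.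
apply: continuous_big => [|i _ l]; first by move=> x; exact: add_continuous.
under eq_fun do rewrite mxE.
apply: cvgMl_tmp; first exact: nbhs_filter.
apply: continuous_cvg; [exact: nbhs_filter | exact: continuous_expR |].
exact: continuous_mulmx_coord.
Qed.

Lemma exp_family_shift (R : realType) (m n : nat) (w : 'cV[R]_n)
    (Q : 'M[R]_(m, n)) (l u : 'rV[R]_m) (e : R) i :
  exp_family w Q (l + e *: u) i 0 =
  exp_family w Q l i 0 * expR (e * (u *m Q) 0 i).
Proof.
rewrite mxE [in RHS]mxE -mulrA -expRD; congr (_ * expR _).
exact: mulmx_combination_coord.
Qed.

(** The normalization of [x] excludes the empty sum. *)
Lemma sum_mul_gt0 (R : realType) (n : nat) (a x : 'I_n -> R) :
  (forall i, 0 < a i) -> (forall i, 0 < x i) -> \sum_i x i = 1 ->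
  0 < \sum_i a i * x i.
Proof.
move=> a0 x0 x1; have ax0 i : 0 < a i * x i by exact: mulr_gt0.
rewrite lt_neqAle eq_sym sumr_ge0 ?andbT => [|i _]; last exact: ltW.
apply/negP => /eqP /psumr_eq0P z; move/eqP: x1; rewrite eq_sym big1 ?oner_eq0//.
move=> i _; have := ax0 i; rewrite z ?ltxx// => j _; exact: ltW.
Qed.

(** Moving along [- zeta] shrinks every coordinate: [expR (- t * M 0 i) <= (t * M 0 i)^-1] bounds
    the sum by [S / t], and [t = 1 + S]. *)
Lemma exp_family_sum_le1 (R : realType) (m n : nat) (w : 'cV[R]_n)
    (Q : 'M[R]_(m, n)) (zeta : 'rV[R]_m) :
  positive_vector w -> (forall i, 0 < (zeta *m Q) 0 i) ->
  exists l, \sum_i exp_family w Q l i 0 <= 1.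
Proof.
move=> w0 M0; set M := zeta *m Q in M0.
pose S := \sum_i w i 0 / M 0 i; pose t := 1 + S.
have S0 : 0 <= S by apply: sumr_ge0 => i _; rewrite divr_ge0// ltW.
have t0 : 0 < t by rewrite /t; lra.
exists (- t *: zeta); apply: (@le_trans _ _ (t^-1 * S)); last first.
  by rewrite mulrC ler_pdivrMr// mul1r /t; lra.
rewrite /S mulr_sumr; apply: ler_sum => i _.
rewrite mxE mulrCA ler_pM2l// -scalemxAl mxE -/M mulNr expRN -invfM.
rewrite lef_pV2 ?posrE ?expR_gt0 ?mulr_gt0//.
by have := expR_ge1Dx (t * M 0 i); lra.
Qed.

Lemma exp_family_maximizer (R : realType) (m n : nat) (w : 'cV[R]_n)
    (Q : 'M[R]_(m, n)) (b : 'cV[R]_m) (zeta : 'rV[R]_m) :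
  positive_vector w -> conserved_quantities_positive Q b ->
  (forall i, 0 < (zeta *m Q) 0 i) ->
  exists2 l, \sum_i exp_family w Q l i 0 <= 1 &
    forall l', \sum_i exp_family w Q l' i 0 <= 1 ->
      (l' *m b) 0 0 <= (l *m b) 0 0.
Proof.
move=> w0 bpos M0; have [l0 hl0] := exp_family_sum_le1 w0 M0.
pose h l := \sum_i exp_family w Q l i 0.
pose F := [set l | h l <= 1] `&` [set l | (l0 *m b) 0 0 <= (l *m b) 0 0].
have F0 : F !=set0 by exists l0; split => /=.
have clF : closed F.
  apply: closedI.
    apply: (preimage_closed _ (@closed_le _ 1)) => y _.
    exact: continuous_exp_family_sum.
  apply: (preimage_closed _ (@closed_ge _ ((l0 *m b) 0 0))) => y _.
  exact: continuous_mulmx_coord.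
(* On [F], each coordinate of [l *m Q] is below its exponential, hence at most [(w i 0)^-1], and
   [- (l *m b)] is at most the absolute value of [l0 *m b]. So [C] bounds all the forms of
   [row_mx Q (- b)]. *)
pose C := \sum_i (w i 0)^-1 + `|(l0 *m b) 0 0|.
have bF : bounded_set F.
  have := @polyhedron_bounded R m (n + 1) (row_mx Q (- b)) C.
  have coordl (y : 'rV[R]_m) i :
      (y *m row_mx Q (- b)) 0 (lshift 1 i) = (y *m Q) 0 i.
    by rewrite mul_mx_row row_mxEl.
  have coordr (y : 'rV[R]_m) i :
      (y *m row_mx Q (- b)) 0 (rshift n i) = - (y *m b) 0 0.
    by rewrite mul_mx_row row_mxEr mulmxN mxE ord1.
  have wV i : 0 <= (w i 0)^-1 by rewrite invr_ge0 ltW.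
  case=> [y ley|B [Br FB]].
    (* A nonzero recession direction [y] would make [- y] a nonnegative conserved quantity with
       value at most 0 on [b]. *)
    apply/eqP/contraT => y0; have := bpos (- y).
    rewrite oppr_eq0 => /(_ y0); rewrite !mulNmx => posy.
    have : 0 < (- (y *m b)) 0 0.
      by apply: posy => i; rewrite mxE oppr_ge0 -coordl.
    rewrite [ltRHS]mxE.
    by have := ley (rshift n 0); rewrite coordr; lra.
  exists B; split=> // B' /FB FB' y [hy ly]; apply: FB' => /= j.
  case: (split_ordP j) => i ->; last first.
    rewrite coordr /C; move: ly => /=; set a := (_ *m b) 0 0 => ay.
    have := ler_norm (- a); rewrite normrN.
    have : 0 <= \sum_i (w i 0)^-1 by apply: sumr_ge0.
    by lra.
  rewrite coordl /C; apply: (@le_trans _ _ (w i 0)^-1); last first.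
    apply: (@le_trans _ _ (\sum_i (w i 0)^-1)); last by rewrite lerDl.
    by rewrite (bigD1 i)//= lerDl sumr_ge0.
  rewrite -(ler_pM2l (w0 i)) mulfV ?gt_eqF//; apply: le_trans hy.
  rewrite /h (bigD1 i)//= -[leLHS]addr0 lerD//.
    rewrite [leRHS]mxE ler_pM2l//.
    by have := expR_ge1Dx ((y *m Q) 0 i); lra.
  by apply: sumr_ge0 => k _; rewrite mxE mulr_ge0 ?expR_ge0// ltW.
have [l + lmax] := compact_EVT_max F0 (bounded_closed_compact bF clF)
  (continuous_subspaceT (@continuous_mulmx_coord _ _ _ b 0)).
rewrite inE => -[hl l0l]; exists l => // l' hl'.
have [l0l'|/ltW l'l0] := leP ((l0 *m b) 0 0) ((l' *m b) 0 0).
  by apply: (lmax l'); rewrite inE.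
exact: le_trans l'l0 l0l.
Qed.

Lemma exp_family_normalized_solution (R : realType) (m n : nat) (w : 'cV[R]_n)
    (Q : 'M[R]_(m, n)) (b : 'cV[R]_m) (zeta : 'rV[R]_m) :
  positive_vector w -> conserved_quantities_positive Q b ->
  (forall i, 0 < (zeta *m Q) 0 i) -> (zeta *m b) 0 0 = 1 ->
  exists2 l, \sum_i exp_family w Q l i 0 = 1 &
    Q *m exp_family w Q l =
    (\sum_i (zeta *m Q) 0 i * exp_family w Q l i 0) *: b.
Proof.
move=> w0 bpos M0 zb.
have [l hl lmax] := exp_family_maximizer w0 bpos M0.
set x := exp_family w Q l in hl *.
have x0 i : 0 < x i 0 by rewrite mxE mulr_gt0// expR_gt0.
have x1 : \sum_i x i 0 = 1.
  (* With slack in the constraint, a small step [e] along [zeta] stays feasible and raises the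
     objective by [e], since [zeta *m b] is 1. *)
  apply/eqP; rewrite eq_le hl leNgt; apply/negP => x1.
  pose f (e : R) := \sum_i x i 0 * expR (e * (zeta *m Q) 0 i).
  have cf : continuous f.
    apply: continuous_big => [|i _ e]; first by move=> ?; exact: add_continuous.
    apply: cvgMl_tmp; apply: continuous_cvg; first exact: continuous_expR.
    exact: mulrr_continuous.
  have f1 : f e @[e --> 0^'+] --> \sum_i x i 0.
    have -> : \sum_i x i 0 = f 0.
      by apply: eq_bigr => i _; rewrite mul0r expR0 mulr1.
    exact/cvg_at_right_filter/cf.
  have : \forall e \near 0^'+, 0 < e /\ f e < 1.
    near=> e; split; near: e; first exact: nbhs_right_gt.
    exact: (cvgr_lt _ f1).
  case/filter_ex => e [e0 fe1].
  have : \sum_i exp_family w Q (l + e *: zeta) i 0 <= 1.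
    by under eq_bigr do rewrite exp_family_shift; exact: ltW.
  by move=> /lmax; rewrite mulmx_combination_coord zb; lra.
pose g (u : 'rV[R]_m) := \sum_i x i 0 * (u *m Q) 0 i.
have gE u : g u = (u *m (Q *m x)) 0 0.
  by rewrite mulmxA mxE; apply: eq_bigr => i _; rewrite mulrC.
(* [g u] is the derivative of the constraint along [u]; a direction of descent leads to feasible
   points and cannot raise the objective. *)
have gneg u : g u < 0 -> (u *m b) 0 0 <= 0.
  move=> /(exp_sum_descent x0)[e e0 he].
  have : \sum_i exp_family w Q (l + e *: u) i 0 <= 1.
    by under eq_bigr do rewrite exp_family_shift; rewrite -x1 ltW.
  by move=> /lmax; rewrite mulmx_combination_coord gerDl pmulr_rle0.
exists l => //; rewrite -/x; set T := \sum_i _.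
have T0 : 0 < T by exact: sum_mul_gt0.
have gz : g zeta = T by apply: eq_bigr => i _; rewrite mulrC.
(* Adding a multiple of [zeta] shifts [g] to [- (d * T) < 0], with [d] arbitrarily small. *)
have gle u : (u *m b) 0 0 <= g u / T.
  apply/ler_addgt0Pr => d d0; pose c := - (g u / T + d).
  have gv : g (u + c *: zeta) = - (d * T).
    rewrite gE mulmx_combination_coord -!gE gz /c.
    by field; rewrite gt_eqF.
  have : g (u + c *: zeta) < 0 by rewrite gv oppr_lt0 mulr_gt0.
  by move=> /gneg; rewrite mulmx_combination_coord zb /c; lra.
(* The inequality for [u] and [- u] is an equality, then tested on the basis rows. *)
have gT (u : 'rV[R]_m) : (u *m (Q *m x)) 0 0 = T * (u *m b) 0 0.
  have oppE (c : 'cV[R]_m) : (- u *m c) 0 0 = - (u *m c) 0 0.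
    by rewrite mulNmx mxE.
  have := gle (- u); have := gle u; rewrite !gE !oppE !ler_pdivlMr//.
  by lra.
apply/colP => i; have := gT (delta_mx 0 i).
by rewrite -!rowE !mxE.
Unshelve. all: by end_near.
Qed.

(** * Uniqueness within the exponential family *)

(* [expR s - 1 - s] is nonnegative and vanishes only at 0; summing it against
   [x] and, with the opposite exponent, against [y] forces [s = 0]. *)
Lemma exp_family_solution_unique (R : realType) (m n : nat) (Q : 'M[R]_(m, n))
    (b : 'cV[R]_m) (x y : 'cV[R]_n) (nu : 'rV[R]_m) (a c : R) :
  positive_vector x -> positive_vector y ->
  (forall i, y i 0 = x i 0 * expR ((nu *m Q) 0 i)) ->
  \sum_i x i 0 = \sum_i y i 0 -> 0 < a -> 0 < c ->
  Q *m x = a *: b -> Q *m y = c *: b -> y = x.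
Proof.
move=> x0 y0 yE sxy a0 c0 Qx Qy; set s := nu *m Q in yE *.
have sv (v : 'cV[R]_n) t : Q *m v = t *: b ->
    \sum_i v i 0 * s 0 i = t * (nu *m b) 0 0.
  move=> Qv; have : (nu *m (Q *m v)) 0 0 = t * (nu *m b) 0 0.
    by rewrite Qv -scalemxAr mxE.
  by move=> <-; rewrite mulmxA mxE; apply: eq_bigr => i _; rewrite mulrC.
have dx i : 0 <= y i 0 - x i 0 - x i 0 * s 0 i.
  by have := expR_ge1Dx (s 0 i); rewrite yE -(ler_pM2l (x0 i)); lra.
have dy i : 0 <= x i 0 - y i 0 + y i 0 * s 0 i.
  have -> : x i 0 = y i 0 * expR (- s 0 i).
    by rewrite yE expRN mulfK// expR_eq0.
  by have := expR_ge1Dx (- s 0 i); rewrite -(ler_pM2l (y0 i)); lra.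
have sdx : \sum_i (y i 0 - x i 0 - x i 0 * s 0 i) = - (a * (nu *m b) 0 0).
  by rewrite 2!sumrB (sv _ _ Qx) sxy; lra.
(* The two nonnegative sums equal [- a] and [c] times this number, and [a] and [c] are positive. *)
have nb0 : (nu *m b) 0 0 = 0.
  have : 0 <= \sum_i (y i 0 - x i 0 - x i 0 * s 0 i) by apply: sumr_ge0.
  have : 0 <= \sum_i (x i 0 - y i 0 + y i 0 * s 0 i) by apply: sumr_ge0.
  rewrite sdx big_split/= sumrB (sv _ _ Qy) sxy; nra.
move: sdx; rewrite nb0 mulr0 oppr0 => /psumr_eq0P dx0.
apply/colP => i; have := dx0 (fun i _ => dx i) i isT.
have [s0 _|s0] := eqVneq (s 0 i) 0; first by rewrite yE s0 expR0 mulr1.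
by have := expR_gt1Dx s0; rewrite yE -(ltr_pM2l (x0 i)); lra.
Qed.

(** * Detailed balance and the left kernel of the Wegscheider matrix *)

Lemma vpow_mul_expR (R : realType) (n : nat) (x y e : 'cV[R]_n) (s : 'rV[R]_n) :
  positive_vector x -> (forall i, y i 0 = x i 0 * expR (s 0 i)) ->
  vpow y e = vpow x e * expR ((s *m e) 0 0).
Proof.
move=> x0 yE; rewrite mxE expR_sum /vpow -big_split /=.
apply: eq_bigr => i _; rewrite yE powRM ?expR_ge0 ?ltW//.
by rewrite expRM.
Qed.

Lemma vpow_gt0 (R : realType) (n : nat) (x e : 'cV[R]_n) :
  positive_vector x -> 0 < vpow x e.
Proof. by move=> x0; apply: prodr_gt0 => i _; exact: powR_gt0. Qed.

(** Dividing the balance of [y] by that of [x] leaves [expR] of [s *m alpha a] equal to [expR] of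
    [s *m beta a], and [expR] is injective. *)
Lemma detailed_balanced_expR (R : realType) (n N : nat)
    (alpha beta : 'I_N -> 'cV[R]_n) (kf kb : 'I_N -> R)
    (hkf : forall a, 0 < kf a) (x y : 'cV[R]_n) (s : 'rV[R]_n) :
  detailed_balanced alpha beta kf kb x ->
  (forall i, y i 0 = x i 0 * expR (s 0 i)) ->
  detailed_balanced alpha beta kf kb y <-> s *m wegscheider alpha beta = 0.
Proof.
move=> [x0 xE] yE.
have y0 : positive_vector y by move=> i; rewrite yE mulr_gt0 ?expR_gt0.
have sW a : (s *m wegscheider alpha beta) 0 a =
    (s *m beta a) 0 0 - (s *m alpha a) 0 0.
  by rewrite !mxE -sumrB; apply: eq_bigr => i _; rewrite mxE mulrBr.
have balE a : kf a * vpow y (alpha a) = kb a * vpow y (beta a) <->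
    (s *m alpha a) 0 0 = (s *m beta a) 0 0.
  rewrite !(vpow_mul_expR _ x0 yE) !mulrA -xE; split=> [|-> //].
  have k0 : kf a * vpow x (alpha a) != 0 by rewrite gt_eqF// mulr_gt0// vpow_gt0.
  by move=> /(mulfI k0)/expR_inj.
split=> [[_ yb]|sW0].
  by apply/rowP => a; rewrite sW ((balE a).1 (yb a)) subrr mxE.
split=> // a; apply/balE/eqP; rewrite eq_sym -subr_eq0 -sW sW0.
by rewrite mxE.
Qed.

Lemma concentration_law (R : realType) (m n : nat) (Q : 'M[R]_(m, n))
    (M x : 'cV[R]_n) (b : 'cV[R]_m) :
  \sum_j M j 0 * x j 0 != 0 ->
  Q *m concentration M x = b <-> Q *m x = (\sum_j M j 0 * x j 0) *: b.
Proof.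
move=> T0; set T := \sum_j _ in T0 *.
have -> : concentration M x = T^-1 *: x.
  by apply/colP => i; rewrite !mxE mulrC.
rewrite -scalemxAr; split=> [<-|->]; first by rewrite scalerA mulfV// scale1r.
by rewrite scalerA mulVf// scale1r.
Qed.

(** * Existence and uniqueness of the normalized equilibrium *)

Theorem theorem10 (R : realType) (n N m d : nat)
    (M : 'cV[R]_n) (hM : positive_vector M)
    (alpha beta : 'I_N -> 'cV[R]_n)
    (halpha : stoichiometric_exponents alpha)
    (hbeta : stoichiometric_exponents beta)
    (kf kb : 'I_N -> R)
    (hkf : forall a, 0 < kf a) (hkb : forall a, 0 < kb a)
    (hmass : M^T *m wegscheider alpha beta = 0)
    (hm : m = \rank (kermx (wegscheider alpha beta))) (hm1 : (1 <= m)%N)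
    (Q : 'M[R]_(m, n)) (hQ : kernel_basis Q (wegscheider alpha beta))
    (hd : (1 <= d)%N)
    (mu : {measure set (borel_rV R d) -> \bar R}) (hmu : is_lebesgue_measure mu)
    (Omega : set (borel_rV R d)) (hOmega : is_domain Omega)
    (hOmega1 : mu Omega = 1%E)
    (rho0 : 'I_n -> borel_rV R d -> R)
    (hrho0 : initial_densities mu Omega rho0)
    (hE : detailed_balanced alpha beta kf kb !=set0)
    (M0 : 'cV[R]_m)
    (hM0 : M0 = initial_mass_vector mu Omega M Q rho0)
    (hM0pos : positive_vector M0)
    (hM0cons : conserved_quantities_positive Q M0)
    (zeta : 'rV[R]_m) (hzeta : zeta *m Q = M^T)
    (hzetaM0 : (zeta *m M0) 0 0 = 1) :
  exists! x : 'cV[R]_n,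
    detailed_balanced alpha beta kf kb x /\
    Q *m concentration M x = M0 /\
    \sum_(i < n) x i 0 = 1.
Proof.
have {hE}[w wE] := hE; have w0 : positive_vector w by case: wE.
have zQ i : (zeta *m Q) 0 i = M i 0 by rewrite hzeta mxE.
have zQ0 i : 0 < (zeta *m Q) 0 i by rewrite zQ.
have [_ eqQ] := hQ.
have kerW (s : 'rV[R]_n) :
    s *m wegscheider alpha beta = 0 <-> exists nu : 'rV[R]_m, s = nu *m Q.
  by rewrite (rwP sub_kermxP) -eqQ (rwP submxP).
have [l x1 Qx] := exp_family_normalized_solution w0 hM0cons zQ0 hzetaM0.
set x := exp_family w Q l in x1 Qx.
have xE : detailed_balanced alpha beta kf kb x.
  apply/(detailed_balanced_expR hkf wE (s := l *m Q)).
    by move=> i; rewrite mxE.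
  by apply/kerW; exists l.
have x0 : positive_vector x by case: xE.
have Mgt0 (v : 'cV[R]_n) : positive_vector v -> \sum_i v i 0 = 1 ->
    0 < \sum_j M j 0 * v j 0 by exact: sum_mul_gt0.
have Qx' : Q *m x = (\sum_j M j 0 * x j 0) *: M0.
  by rewrite Qx; congr (_ *: _); apply: eq_bigr => i _; rewrite zQ.
exists x; split.
  by split=> //; split=> //; apply/concentration_law; rewrite ?gt_eqF ?Mgt0.
move=> y [yE [yc y1]]; have y0 : positive_vector y by case: yE.
(* The logarithmic ratio is taken relative to the constructed [x], itself an equilibrium, so that
   [x] and [y] are compared directly. *)
pose s : 'rV[R]_n := \row_i ln (y i 0 / x i 0).
have yxs i : y i 0 = x i 0 * expR (s 0 i).
  by rewrite [s 0 i]mxE lnK ?posrE ?divr_gt0// mulrC divfK// gt_eqF.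
have /kerW[nu snu] : s *m wegscheider alpha beta = 0.
  exact/(detailed_balanced_expR hkf xE yxs).
(* The multipliers are the total masses of [x] and [y], which are not known to agree beforehand. *)
apply/esym/(exp_family_solution_unique (nu := nu) x0 y0 _ _ (Mgt0 _ x0 x1)
  (Mgt0 _ y0 y1) Qx').
- by move=> i; rewrite -snu.
- by rewrite x1 y1.
- by apply/concentration_law => //; rewrite gt_eqF ?Mgt0.
Qed.
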